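(* Let $n\ge 1$. Any Kähler potential of the Bergman--Poincaré metric $\omega_{\mathbb B^n}$ on the unit ball $\mathbb B^n$ which has constant differential norm is $\log\varphi_0$ up to the isotropy subgroup of $\mathbb B^n$ at $0$. That is, if $\eta\colon\mathbb B^n\to\mathbb R$ is smooth with $\sqrt{-1}\,\partial\bar\partial\eta=\omega_{\mathbb B^n}$ and $\|\partial\eta\|_{\omega_{\mathbb B^n}}$ is constant on $\mathbb B^n$, then there exist a holomorphic automorphism $\tau$ of $\mathbb B^n$ with $\tau(0)=0$ and a constant $b\in\mathbb R$ such that $\eta=\log\varphi_0\circ\tau+b$ on $\mathbb B^n$.
   Context: $\mathbb B^n=\{z\in\mathbb C^n:|z|<1\}$, $\omega_{\mathbb B^n}=-(n+1)\sqrt{-1}\,\partial\bar\partial\log(1-|z|^2)$ (the Bergman metric, Kähler--Einstein with Ricci curvature $-1$), and $\varphi_0(z)=\dfrac{|1-z_n|^{2(n+1)}}{(1-|z|^2)^{n+1}}$. If $\omega=\sqrt{-1}\sum g_{i\bar j}\,dz_i\wedge d\bar z_j$, and $(g^{k\bar j})$ is the inverse defined by $\sum_j g_{i\bar j}g^{k\bar j}=\delta_{ik}$, then for real $\eta$, $\|\partial\eta\|_\omega^2=\sum_{k,j}g^{k\bar j}\frac{\partial\eta}{\partial z_k}\frac{\partial\eta}{\partial\bar z_j}$. *)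

(* Defs.v *)
From HB Require Import structures.
From mathcomp Require Import all_boot all_order all_algebra.
From mathcomp Require Import complex.
From mathcomp Require Import all_classical all_reals all_analysis.

Set Implicit Arguments.
Unset Strict Implicit.
Unset Printing Implicit Defensive.

Import Order.TTheory GRing.Theory Num.Theory.
Import numFieldNormedType.Exports.

Local Open Scope classical_set_scope.
Local Open Scope ring_scope.
Local Open Scope complex_scope.

(* C^n is 'rV[R[i]]_n.  It is a normed module over R[i] only,
   so real partial derivatives are taken along the real lines
   t |-> z + t *: v, while `differentiable` on 'rV[R[i]]_n is complex
   differentiability. *)

Section CalculusOnCn.
Context {R : realType} {n : nat}.
Local Notation C := R[i].
Implicit Types (U : set 'rV[C]_n) (z v : 'rV[C]_n) (k : 'I_n).

(* The directions of the real coordinates x_k and y_k, where z_k = x_k + i y_k. *)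
Definition xdir k : 'rV[C]_n := delta_mx 0 k.
Definition ydir k : 'rV[C]_n := 'i%C *: delta_mx 0 k.

Definition along (f : 'rV[C]_n -> R) z v : R -> R :=
  fun t => f (z + t%:C *: v).

Definition rpartial v (f : 'rV[C]_n -> R) : 'rV[C]_n -> R :=
  fun z => derive1 (along f z v) 0.

Fixpoint Cdiff_on (r : nat) U (f : 'rV[C]_n -> R) : Prop :=
  (forall z, U z ->
     {for z, continuous (f : ('rV[C]_n : normedModType C) -> R)}) /\
  if r is s.+1 then
    forall k v, v = xdir k \/ v = ydir k ->
      (forall z, U z -> derivable (along f z v) 0 1) /\
      Cdiff_on s U (rpartial v f)
  else True.

(* C^oo in the real sense, on an open set U *)
Definition smooth_on U (f : 'rV[C]_n -> R) : Prop :=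
  forall r, Cdiff_on r U f.

Definition cpartial v (f : 'rV[C]_n -> C) : 'rV[C]_n -> C :=
  fun z => rpartial v (fun w => complex.Re (f w)) z
           +i* rpartial v (fun w => complex.Im (f w)) z.

(* The Wirtinger derivatives d/dz_k and d/d(conj z_k). *)
Definition dz k (f : 'rV[C]_n -> C) : 'rV[C]_n -> C :=
  fun z => 2^-1 * (cpartial (xdir k) f z - 'i%C * cpartial (ydir k) f z).
Definition dzbar k (f : 'rV[C]_n -> C) : 'rV[C]_n -> C :=
  fun z => 2^-1 * (cpartial (xdir k) f z + 'i%C * cpartial (ydir k) f z).

Definition cplx (f : 'rV[C]_n -> R) : 'rV[C]_n -> C := fun z => (f z)%:C.

(* A real (1,1)-form i * \sum g_(i,j) dz_i /\ d(conj z_j) is represented by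
   its coefficient matrix (g_(i,j)); this is the matrix of
   i * del delbar f. *)
Definition ddbar (f : 'rV[C]_n -> R) z : 'M[C]_n :=
  \matrix_(i, j) dz i (dzbar j (cplx f)) z.

(* (g^(k,j)) with \sum_j g_(i,j) g^(k,j) = delta_(i,k), hence the transpose. *)
Definition inv_metric (g : 'M[C]_n) : 'M[C]_n := (invmx g)^T.

Definition del_sqnorm (omega : 'rV[C]_n -> 'M[C]_n) (f : 'rV[C]_n -> R) z : C :=
  \sum_k \sum_j inv_metric (omega z) k j
                * dz k (cplx f) z * dzbar j (cplx f) z.

Definition del_norm (omega : 'rV[C]_n -> 'M[C]_n) (f : 'rV[C]_n -> R) z : C :=
  sqrtC (del_sqnorm omega f z).

(* The Euclidean |z|^2; the norm `|z| of 'rV[C]_n is the sup norm. *)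
Definition sqnorm z : R := \sum_(i < n) ComplexField.Normc.normc (z 0 i) ^+ 2.

Definition unit_ball : set 'rV[C]_n := [set z | sqnorm z < 1].

Definition bergman z : 'M[C]_n :=
  - n.+1%:R *: ddbar (fun w => ln (1 - sqnorm w)) z.

Definition holomorphic_on U (f : 'rV[C]_n -> 'rV[C]_n) : Prop :=
  forall z : ('rV[C]_n : normedModType C), U z ->
    differentiable (f : _ -> ('rV[C]_n : normedModType C)) z.

Definition automorphism_on U (f : 'rV[C]_n -> 'rV[C]_n) : Prop :=
  exists g : 'rV[C]_n -> 'rV[C]_n,
    [/\ {homo f : z / U z}, {homo g : z / U z},
        holomorphic_on U f, holomorphic_on U g &
        forall z, U z -> g (f z) = z /\ f (g z) = z].

End CalculusOnCn.

(* The dimension is n.+1, so the exponents 2(dim + 1) and dim + 1 read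
   2 * n.+2 and n.+2, and z_dim is the entry of index ord_max. *)
Definition phi0 {R : realType} {n : nat} (z : 'rV[R[i]]_n.+1) : R :=
  ComplexField.Normc.normc (1 - z 0 ord_max) ^+ (2 * n.+2)
  / (1 - sqnorm z) ^+ n.+2.

(* Main.v *)
(* Let d be the dimension, N = d + 1 and rho = 1 - |z|^2.  The function
   eta / N + ln rho is pluriharmonic, so its (1,0)-differential has holomorphic
   coefficients f_k.  Put E = \sum_k z_k f_k.  That the norm of the differential
   of eta is constant becomes
       |1 - E|^2 - \sum_k |f_k|^2 = kappa / rho
   with kappa constant.  Differentiating this identity in z_i and conj z_j gives,
   at the origin, the Gram matrix kappa * I of d + 1 vectors for a form of
   signature (1, d), which forces kappa = 0.  Then f / (1 - E) is a holomorphic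
   map into the unit sphere, hence a constant a, and solving for f gives
   f_k = a_k / (1 + \sum_k z_k a_k).  A unitary map whose last component is
   - \sum_k z_k a_k is the required automorphism. *)

Require Import Defs.
From mathcomp Require Import all_boot all_order all_algebra.
From mathcomp Require Import perm complex spectral ring lra.
From mathcomp Require Import all_classical all_reals all_analysis.
Local Open Scope ring_scope.

Set Implicit Arguments.
Unset Strict Implicit.
Unset Printing Implicit Defensive.

Import Order.TTheory GRing.Theory Num.Theory.
Import numFieldNormedType.Exports.

Local Open Scope classical_set_scope.
Local Open Scope ring_scope.
Local Open Scope complex_scope.

(** * Complex-valued curves *)

(* [conjc] and [Num.conj] share the notation [^*] in different scopes; a single
   constant keeps them from being mixed. *)
Definition cconj {R : realType} (x : R[i]) : R[i] := conjc x.
Local Notation "x ^*" := (cconj x) : complex_scope.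
Local Notation "x ^*" := (cconj x) : ring_scope.

Section Conjugation.
Context {R : realType}.
Local Notation C := R[i].
Implicit Types x y : C.

Lemma cconjD x y : (x + y)^* = x^* + y^*.
Proof. exact: rmorphD. Qed.

Lemma cconjN x : (- x)^* = - x^*.
Proof. exact: rmorphN. Qed.

Lemma cconjM x y : (x * y)^* = x^* * y^*.
Proof. exact: rmorphM. Qed.

Lemma cconj_nat m : (m%:R : C)^* = m%:R.
Proof. exact: rmorph_nat. Qed.

Lemma cconj0 : (0 : C)^* = 0.
Proof. exact: rmorph0. Qed.

Lemma cconj1 : (1 : C)^* = 1.
Proof. exact: rmorph1. Qed.

Lemma cconjV x : (x^-1)^* = (x^*)^-1.
Proof. exact: fmorphV. Qed.

Lemma cconj_sum (I : Type) (r : seq I) (F : I -> C) :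
  (\sum_(i <- r) F i)^* = \sum_(i <- r) (F i)^*.
Proof. exact: rmorph_sum. Qed.

Lemma cconj_real (x : R) : (x%:C)^* = x%:C.
Proof. exact: conjc_real. Qed.

Lemma cconjK : involutive (@cconj R).
Proof. exact: conjcK. Qed.

Lemma cconj_eq0 x : (x^* == 0) = (x == 0).
Proof. exact: conjc_eq0. Qed.

Lemma mul_cconj_ge0 x : 0 <= x * x^*.
Proof. exact: mulcJ_ge0. Qed.

End Conjugation.

Section ComplexCurves.
Context {R : realType}.
Local Notation C := R[i].
Local Notation Re := (@complex.Re R).
Local Notation Im := (@complex.Im R).
Implicit Types (c e : R -> C) (t : R) (d : C).

(** The derivative is taken componentwise because the parameter is real while [R[i]] is normed over
    itself. The predicate carries existence and value together, so the rules below need no separate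
    derivability conditions. *)
Definition is_cderive c t d : Prop :=
  is_derive t 1 (fun s => Re (c s)) (Re d) /\
  is_derive t 1 (fun s => Im (c s)) (Im d).

Lemma ReD (x y : C) : Re (x + y) = Re x + Re y.
Proof. by case: x y => [a b] [u v]. Qed.

Lemma ImD (x y : C) : Im (x + y) = Im x + Im y.
Proof. by case: x y => [a b] [u v]. Qed.

Lemma ReJ (x : C) : Re x^* = Re x.
Proof. by case: x. Qed.

Lemma ImJ (x : C) : Im x^* = - Im x.
Proof. by case: x. Qed.

Lemma ReM (x y : C) : Re (x * y) = Re x * Re y - Im x * Im y.
Proof. by case: x y => [a b] [u v]. Qed.

Lemma ImM (x y : C) : Im (x * y) = Re x * Im y + Im x * Re y.
Proof. by case: x y => [a b] [u v]. Qed.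

Lemma eqC (x y : C) : Re x = Re y -> Im x = Im y -> x = y.
Proof. by case: x y => [a b] [u v] /= -> ->. Qed.

Lemma mulCJ (x : C) : x * x^* = (Re x ^+ 2 + Im x ^+ 2)%:C.
Proof. by case: x => a b; apply: eqC => /=; ring. Qed.

Lemma is_cderive_eq c t d d' : is_cderive c t d -> d = d' -> is_cderive c t d'.
Proof. by move=> h <-. Qed.

Lemma is_cderive_cst (a : C) t : is_cderive (fun=> a) t 0.
Proof. by split; exact: is_derive_cst. Qed.

Lemma is_cderiveD c e t dc de : is_cderive c t dc -> is_cderive e t de ->
  is_cderive (fun s => c s + e s) t (dc + de).
Proof.
move=> [c1 c2] [e1 e2]; split.
- have -> : (fun s => Re (c s + e s)) = (Re \o c) + (Re \o e).
    by apply/funext => s; rewrite ReD.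
  rewrite ReD; exact: is_deriveD.
- have -> : (fun s => Im (c s + e s)) = (Im \o c) + (Im \o e).
    by apply/funext => s; rewrite ImD.
  rewrite ImD; exact: is_deriveD.
Qed.

Lemma is_cderiveM c e t dc de : is_cderive c t dc -> is_cderive e t de ->
  is_cderive (fun s => c s * e s) t (dc * e t + c t * de).
Proof.
move=> [c1 c2] [e1 e2]; split.
- have -> : (fun s => Re (c s * e s)) = (Re \o c) * (Re \o e) - (Im \o c) * (Im \o e).
    by apply/funext => s; rewrite ReM.
  apply: is_derive_eq; rewrite /= /GRing.scale /=.
  by case: (c t) (e t) (dc) (de) => [? ?] [? ?] [? ?] [? ?] /=; ring.
- have -> : (fun s => Im (c s * e s)) = (Re \o c) * (Im \o e) + (Im \o c) * (Re \o e).
    by apply/funext => s; rewrite ImM.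
  apply: is_derive_eq; rewrite /= /GRing.scale /=.
  by case: (c t) (e t) (dc) (de) => [? ?] [? ?] [? ?] [? ?] /=; ring.
Qed.

Lemma is_cderiveJ c t d : is_cderive c t d -> is_cderive (fun s => (c s)^*) t d^*.
Proof.
move=> [c1 c2]; split.
- have -> : (fun s => Re (c s)^*) = Re \o c by apply/funext => s; rewrite ReJ.
  by rewrite ReJ.
- have -> : (fun s => Im (c s)^*) = - (Im \o c) by apply/funext => s; rewrite ImJ.
  rewrite ImJ; exact: is_deriveN.
Qed.

Lemma is_cderive_real (r : R -> R) t (d : R) :
  is_derive t 1 r d -> is_cderive (fun s => (r s)%:C) t d%:C.
Proof. by move=> rd; split => //=; exact: is_derive_cst. Qed.

Lemma is_cderiveV c t d : c t != 0 -> is_cderive c t d ->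
  is_cderive (fun s => (c s)^-1) t (- d / c t ^+ 2).
Proof.
move=> ct0 cd; have [c1 c2] := cd.
pose N s : R := Re (c s) ^+ 2 + Im (c s) ^+ 2.
have NE s : (N s)%:C = c s * (c s)^* by rewrite mulCJ.
have Jct0 : (c t)^* != 0 by rewrite cconj_eq0.
have Nt0 : N t != 0.
  by apply/eqP => h; have := NE t; rewrite h => /esym/eqP; rewrite mulf_eq0 (negPf ct0) (negPf Jct0).
(* The inverse is the conjugate divided by the squared modulus [N], which leaves only a real inverse
   to differentiate. With 0^-1 = 0 this holds at zeros of [c] too, so the two functions agree
   everywhere. *)
have -> : (fun s => (c s)^-1) = (fun s => (c s)^* * ((N s)^-1)%:C).
  apply/funext => s; have [->|cs0] := eqVneq (c s) 0.
    by rewrite invr0 cconj0 mul0r.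
  have Jcs0 : (c s)^* != 0 by rewrite cconj_eq0.
  by rewrite fmorphV /= NE; field; rewrite cs0 Jcs0.
pose D := (2 * (Re (c t) * Re d + Im (c t) * Im d)).
have ND : is_derive t 1 N D.
  have -> : N = (Re \o c) * (Re \o c) + (Im \o c) * (Im \o c).
    by apply/funext => s; rewrite /N !expr2.
  by apply: is_derive_eq; rewrite /= /GRing.scale /= /D; ring.
have DE : D%:C = d * (c t)^* + c t * d^*.
  by rewrite /D; case: (c t) (d) => [? ?] [? ?]; apply: eqC => /=; ring.
have VD : is_cderive (fun s => ((N s)^-1)%:C) t (- (N t) ^- 2 *: D)%:C.
  by apply: is_cderive_real; exact: is_deriveV.
apply: is_cderive_eq (is_cderiveM (is_cderiveJ cd) VD) _.
rewrite /GRing.scale /= rmorphM rmorphN !fmorphV rmorphXn /= NE DE.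
by field; rewrite ct0 Jct0.
Qed.

Lemma is_cderive_near c e t d : (\near t, c t = e t) ->
  is_cderive c t d -> is_cderive e t d.
Proof.
move=> ce [c1 c2]; split; [move: c1|move: c2]; apply: near_eq_is_derive;
  by apply: filterS ce => s ->.
Qed.

Lemma is_cderive_ln (r : R -> R) t (d : C) : 0 < r t ->
  is_cderive (fun s => (r s)%:C) t d ->
  is_cderive (fun s => (ln (r s))%:C) t (d / (r t)%:C).
Proof.
move=> rt0 [r1 r2].
(* The curve is real valued, so its derivative is a real number. *)
have d0 : Im d = 0 by have [_ <-] := r2; rewrite derive_cst.
have -> : d / (r t)%:C = ((r t)^-1 * Re d)%:C.
  rewrite mulrC rmorphM fmorphV /=; congr (_ * _); exact: eqC.
apply: is_cderive_real.
by apply: (is_derive1_comp (f := @ln R)); exact: is_derive1_ln.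
Qed.

End ComplexCurves.

(** * Wirtinger derivatives *)

Section Wirtinger.
Context {R : realType} {n : nat}.
Local Notation C := R[i].
Local Notation Re := (@complex.Re R).
Local Notation Im := (@complex.Im R).
Implicit Types (f g : 'rV[C]_n -> C) (z v : 'rV[C]_n) (k : 'I_n) (a b : C).

Definition is_dirderive v f z d : Prop :=
  is_cderive (fun t => f (z + t%:C *: v)) 0 d.

(* [a] is the derivative in z_k and [b] the one in conj z_k. *)
Definition is_wirtinger k f z a b : Prop :=
  is_dirderive (xdir k) f z (a + b) /\
  is_dirderive (ydir k) f z ('i%C * (a - b)).

Lemma along0 z v : z + (0 : R)%:C *: v = z.
Proof. by rewrite scale0r addr0. Qed.

Lemma is_dirderive_cpartial v f z d : is_dirderive v f z d -> cpartial v f z = d.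
Proof.
move=> [h1 h2]; apply: eqC => /=; rewrite /rpartial derive1E.
- by have [_ <-] := h1.
- by have [_ <-] := h2.
Qed.

Lemma is_wirtinger_dz k f z a b : is_wirtinger k f z a b -> dz k f z = a.
Proof.
move=> [/is_dirderive_cpartial hx /is_dirderive_cpartial hy].
by rewrite /dz hx hy mulrA -expr2 sqr_i; field.
Qed.

Lemma is_wirtinger_dzbar k f z a b : is_wirtinger k f z a b -> dzbar k f z = b.
Proof.
move=> [/is_dirderive_cpartial hx /is_dirderive_cpartial hy].
by rewrite /dzbar hx hy mulrA -expr2 sqr_i; field.
Qed.

Lemma derivable_is_wirtinger k f z :
  (forall v, v = xdir k \/ v = ydir k ->
     derivable (along (Re \o f) z v) 0 1 /\ derivable (along (Im \o f) z v) 0 1) ->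
  is_wirtinger k f z (dz k f z) (dzbar k f z).
Proof.
move=> H; have E v : v = xdir k \/ v = ydir k -> is_dirderive v f z (cpartial v f z).
  by move=> /H[h1 h2]; split; rewrite [X in is_derive _ _ _ X]derive1E; exact: derivableP.
have Ex := E _ (or_introl erefl); have Ey := E _ (or_intror erefl).
move: Ex Ey; rewrite /is_wirtinger /dz /dzbar.
move: (cpartial (xdir k) f z) (cpartial (ydir k) f z) => p q Ex Ey.
split; [apply: is_cderive_eq Ex _ | apply: is_cderive_eq Ey _]; first by field.
transitivity (- ('i%C ^+ 2) * q); last by field.
by rewrite sqr_i opprK mul1r.
Qed.

Lemma is_wirtinger_eq k f z a b a' b' :
  is_wirtinger k f z a b -> a = a' -> b = b' -> is_wirtinger k f z a' b'.
Proof. by move=> h <- <-. Qed.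

Lemma is_wirtinger_cst k (c : C) z : is_wirtinger k (fun=> c) z 0 0.
Proof.
by split; apply: is_cderive_eq (is_cderive_cst _ _) _; rewrite ?subr0 ?addr0 ?mulr0.
Qed.

Lemma is_wirtingerD k f g z a b a' b' :
  is_wirtinger k f z a b -> is_wirtinger k g z a' b' ->
  is_wirtinger k (fun w => f w + g w) z (a + a') (b + b').
Proof.
move=> [f1 f2] [g1 g2]; split.
- by apply: is_cderive_eq (is_cderiveD f1 g1) _; ring.
- by apply: is_cderive_eq (is_cderiveD f2 g2) _; ring.
Qed.

Lemma is_wirtingerM k f g z a b a' b' :
  is_wirtinger k f z a b -> is_wirtinger k g z a' b' ->
  is_wirtinger k (fun w => f w * g w) z (a * g z + f z * a') (b * g z + f z * b').
Proof.
move=> [f1 f2] [g1 g2]; split.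
- by apply: is_cderive_eq (is_cderiveM f1 g1) _; rewrite along0; ring.
- by apply: is_cderive_eq (is_cderiveM f2 g2) _; rewrite along0; ring.
Qed.

Lemma is_wirtingerZ k (c : C) f z a b : is_wirtinger k f z a b ->
  is_wirtinger k (fun w => c * f w) z (c * a) (c * b).
Proof.
move=> h; apply: is_wirtinger_eq (is_wirtingerM (is_wirtinger_cst k c z) h) _ _;
  by rewrite mul0r add0r.
Qed.

Lemma is_wirtingerB k f g z a b a' b' :
  is_wirtinger k f z a b -> is_wirtinger k g z a' b' ->
  is_wirtinger k (fun w => f w - g w) z (a - a') (b - b').
Proof.
move=> hf /(is_wirtingerZ (-1)) hg.
have -> : (fun w => f w - g w) = (fun w => f w + -1 * g w).
  by apply/funext => w; rewrite mulN1r.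
by apply: is_wirtinger_eq (is_wirtingerD hf hg) _ _; rewrite mulN1r.
Qed.

Lemma is_wirtinger_sum (I : Type) (r : seq I) k (f : I -> 'rV[C]_n -> C) z (a b : I -> C) :
  (forall i, is_wirtinger k (f i) z (a i) (b i)) ->
  is_wirtinger k (fun w => \sum_(i <- r) f i w) z (\sum_(i <- r) a i) (\sum_(i <- r) b i).
Proof.
move=> H; elim: r => [|i r IH].
  under eq_fun do rewrite big_nil.
  by rewrite !big_nil; exact: is_wirtinger_cst.
under eq_fun do rewrite big_cons.
by rewrite !big_cons; exact: is_wirtingerD.
Qed.

Lemma is_wirtingerJ k f z a b : is_wirtinger k f z a b ->
  is_wirtinger k (fun w => (f w)^*) z b^* a^*.
Proof.
move=> [f1 f2]; split.
- by apply: is_cderive_eq (is_cderiveJ f1) _; rewrite cconjD addrC.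
- apply: is_cderive_eq (is_cderiveJ f2) _.
  by case: (a) (b) => [? ?] [? ?]; apply: eqC => /=; ring.
Qed.

Lemma is_wirtingerV k f z a b : f z != 0 -> is_wirtinger k f z a b ->
  is_wirtinger k (fun w => (f w)^-1) z (- a / f z ^+ 2) (- b / f z ^+ 2).
Proof.
move=> fz0 [f1 f2]; split.
- by apply: is_cderive_eq (is_cderiveV _ f1) _; rewrite along0 //; field.
- by apply: is_cderive_eq (is_cderiveV _ f2) _; rewrite along0 //; field.
Qed.

Lemma is_wirtinger_ln k (r : 'rV[C]_n -> R) z a b : 0 < r z ->
  is_wirtinger k (cplx r) z a b ->
  is_wirtinger k (cplx (fun w => ln (r w))) z (a / (r z)%:C) (b / (r z)%:C).
Proof.
move=> rz0 [f1 f2]; have rz0' : (r z)%:C != 0 by rewrite fmorph_eq0 gt_eqF.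
split.
- apply: is_cderive_eq (is_cderive_ln _ f1) _; rewrite along0 //; field; exact: rz0'.
- apply: is_cderive_eq (is_cderive_ln _ f2) _; rewrite along0 //; field; exact: rz0'.
Qed.

Lemma is_dirderive_coord (i : 'I_n) z v : is_dirderive v (fun w => w 0 i) z (v 0 i).
Proof.
rewrite /is_dirderive; under eq_fun do rewrite !mxE.
have idC : is_cderive (fun s : R => s%:C) 0 1.
  by apply: (is_cderive_real (r := id)); exact: is_derive_id.
apply: is_cderive_eq (is_cderiveD (is_cderive_cst _ _)
  (is_cderiveM idC (is_cderive_cst (v 0 i) _))) _.
by rewrite mulr0 addr0 add0r mul1r.
Qed.

Lemma is_wirtinger_coord (i : 'I_n) k z : is_wirtinger k (fun w => w 0 i) z (i == k)%:R 0.
Proof.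
split; apply: is_cderive_eq (is_dirderive_coord i z _) _; rewrite !mxE eqxx /=.
- by rewrite addr0.
- by rewrite subr0.
Qed.

Lemma sqnormE z : (sqnorm z)%:C = \sum_i z 0 i * (z 0 i)^*.
Proof.
rewrite rmorph_sum; apply: eq_bigr => i _; rewrite mulCJ; congr (_%:C).
by case: (z 0 i) => x y /=; rewrite sqr_sqrtr // addr_ge0 // sqr_ge0.
Qed.

Lemma is_wirtinger_sqnorm k z : is_wirtinger k (cplx (@sqnorm R n)) z (z 0 k)^* (z 0 k).
Proof.
have -> : cplx (@sqnorm R n) = (fun w => \sum_i w 0 i * (w 0 i)^*).
  by apply/funext => w; rewrite /cplx sqnormE.
apply: is_wirtinger_eq (is_wirtinger_sum _ _) _ _ => [i||].
- exact: is_wirtingerM (is_wirtinger_coord i k z) (is_wirtingerJ (is_wirtinger_coord i k z)).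
- rewrite cconj0 (bigD1 k) // big1 => [|i /negPf ->]; rewrite ?eqxx /=; ring.
- rewrite (bigD1 k) // big1 => [|i /negPf ->]; rewrite ?eqxx cconj_nat /=; ring.
Qed.

Lemma ball_near z v : unit_ball z ->
  \forall t \near (0 : R), unit_ball (z + t%:C *: v).
Proof.
move=> zB.
have h : is_cderive (fun t => (sqnorm (z + t%:C *: v))%:C) 0
    (\sum_i (v 0 i * (z 0 i)^* + z 0 i * (v 0 i)^*)).
  rewrite (eq_fun (fun t => sqnormE (z + t%:C *: v))).
  elim: (index_enum _) => [|i r IH].
    rewrite big_nil; under eq_fun do rewrite big_nil; exact: is_cderive_cst.
  rewrite big_cons; under eq_fun do rewrite big_cons.
  apply: is_cderiveD IH; have hi := is_dirderive_coord i z v.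
  by apply: is_cderive_eq (is_cderiveM hi (is_cderiveJ hi)) _; rewrite along0.
have [h1 _] := h.
have c1 : {for (0 : R), continuous (fun t : R => sqnorm (z + t%:C *: v))}.
  by apply: differentiable_continuous; apply/derivable1_diffP; case: h1.
have := c1 => /(_ [set x | x < 1]); apply.
rewrite along0; exact: lt_nbhsl.
Qed.

(** The ball contains a short segment of every real line through [z], so an identity valid on the
    ball can be differentiated there. *)
Lemma is_wirtinger_near k f g z a b : unit_ball z ->
  (forall w, unit_ball w -> f w = g w) ->
  is_wirtinger k f z a b -> is_wirtinger k g z a b.
Proof.
move=> zB fg [f1 f2]; split; [move: f1|move: f2]; apply: is_cderive_near;
  by apply: filterS (ball_near _ zB) => t; exact: fg.
Qed.

End Wirtinger.

(** * Symmetry of mixed partial derivatives *)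

Section MixedPartials.
Context {R : realType} {n : nat}.
Local Notation C := R[i].
Local Notation V := ('rV[C]_n : normedModType C).
Local Notation K := (C : numFieldType).
Implicit Types (f : 'rV[C]_n -> R) (z v w : 'rV[C]_n).

(** [rpartial] only looks at parameter 0; a shift of the parameter gives the derivative along the
    whole line, as the mean value theorem requires. *)
Lemma is_derive_along f z v (s : R) : derivable (along f (z + s%:C *: v) v) 0 1 ->
  is_derive s 1 (fun t => f (z + t%:C *: v)) (rpartial v f (z + s%:C *: v)).
Proof.
move=> /derivableP; rewrite -derive1E -/(rpartial v f _) => h.
have -> : (fun t => f (z + t%:C *: v)) = along f (z + s%:C *: v) v \o (fun t => t - s).
  by apply/funext => t; rewrite /along /= -addrA -scalerDl -rmorphD /= addrCA subrr addr0.
rewrite -[X in is_derive _ _ _ X]mulr1; apply: is_derive1_comp; first by rewrite subrr.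
rewrite -[X in is_derive _ _ _ X]subr0; exact: is_deriveB.
Qed.

Lemma MVT_closed (g dg : R -> R) (a b : R) : a < b ->
  (forall x, a <= x <= b -> is_derive x 1 g (dg x)) ->
  exists2 c, a <= c <= b & g b - g a = dg c * (b - a).
Proof.
move=> ab H; have [x|c|c cab ->] := @MVT _ g dg a b ab.
- by rewrite in_itv => /andP[/ltW ? /ltW ?]; apply: H; apply/andP.
- apply: derivable_within_continuous => x; rewrite in_itv => /H h.
  exact: ex_derive.
- by exists c => //; move: cab; rewrite in_itv => /andP[/ltW -> /ltW ->].
Qed.

Lemma near_parallelogram z v w (P : 'rV[C]_n -> Prop) :
  (\forall x \near (z : V), P x) ->
  exists2 d : R, 0 < d & forall s t : R, 0 <= s <= d -> 0 <= t <= d ->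
    P (z + s%:C *: v + t%:C *: w).
Proof.
move=> /nbhs_normP[e /= e0 eP].
(* The radius [e] lies in [R[i]], whose order makes every positive element real. *)
have [e0R eE] : 0 < complex.Re e /\ e = (complex.Re e)%:C.
  by move: e0; rewrite ltcE => /andP[/eqP ie ?]; split=> //; exact: eqC.
have nE (u : 'rV[C]_n) : exists2 r : R, 0 <= r & `|u : V| = r%:C.
  have : 0 <= `|u : V| by [].
  by rewrite lecE => /andP[/eqP ie ?]; exists (complex.Re `|u|) => //; exact: eqC.
have [a a0 aE] := nE v; have [b b0 bE] := nE w.
(* Here [a] and [b] are the norms of [v] and [w]; the added 1 keeps the denominator positive when
   both vanish and makes the final bound strict. *)
exists (complex.Re e / (a + b + 1)); first by rewrite divr_gt0 // ltr_wpDl // addr_ge0.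
move=> s t /andP[s0 sd] /andP[t0 td]; apply: eP => /=.
rewrite opprD addrA opprD addrA subrr sub0r -opprD normrN.
apply: le_lt_trans (ler_normD _ _) _; rewrite !normrZ aE bE !ger0_norm ?ler0c //.
rewrite eE -!rmorphM -rmorphD ltcR.
apply: le_lt_trans (lerD (ler_wpM2r a0 sd) (ler_wpM2r b0 td)) _.
rewrite -mulrDr mulrAC ltr_pdivrMr; last by rewrite ltr_wpDl // addr_ge0.
by rewrite ltr_pM2l // ltrDl.
Qed.

Lemma unit_ball_near z : unit_ball z ->
  \forall x \near (z : V), unit_ball x.
Proof.
move=> zB.
(* With values in [R[i]], the squared norm is a sum of squared moduli of coordinates, hence
   continuous for the topology of [V]. *)
pose S (x : V) : K := (sqnorm x)%:C.
have cS : S x @[x --> (z : V)] --> S z.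
  have -> : S = (fun x : V => \sum_i (`|x 0 i| : K) ^+ 2).
    apply/funext => x; rewrite /S sqnormE; apply: eq_bigr => i _.
    by rewrite mulCJ add_Re2_Im2.
  elim: (index_enum _) => [|i r IH].
    by rewrite big_nil; under eq_fun do rewrite big_nil; apply: cvg_cst; exact: (nbhs_filter (z : V)).
  rewrite big_cons.
  have -> : (fun x : V => \sum_(j <- i :: r) (`|x 0 j| : K) ^+ 2) =
      (fun x : V => (`|x 0 i| : K) ^+ 2 + \sum_(j <- r) (`|x 0 j| : K) ^+ 2).
    by apply/funext => x; rewrite big_cons.
  have ci : (`|x 0 i| : K) @[x --> (z : V)] --> (`|z 0 i| : K).
    by apply: cvg_norm; exact: (@coord_continuous K 1 n 0 i z).
  by apply: cvgD IH; under eq_fun do rewrite expr2; rewrite expr2; exact: cvgM.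
have e0 : 0 < (1 - sqnorm z)%:C :> C by rewrite ltcR subr_gt0.
have FF := nbhs_filter (z : V).
apply: filterS (cvgr_dist_lt _ _ cS _ e0) => x; rewrite -rmorphB normc_def /= expr0n addr0.
by rewrite sqrtr_sqr ltcR ltr_distlC => /andP[_]; rewrite /unit_ball /=; lra.
Qed.

(** Two uses of the mean value theorem, first along [v] and then along [w], show that the second
    difference of [f] over a parallelogram of size [h] is h^2 times the mixed derivative at an
    intermediate point. Continuity at [z] bounds the error. *)
Lemma mixed_difference f v w z :
  unit_ball z ->
  (forall x, unit_ball x -> derivable (along f x v) 0 1) ->
  (forall x, unit_ball x -> derivable (along (rpartial v f) x w) 0 1) ->
  {for z, continuous (rpartial w (rpartial v f) : V -> R)} ->
  forall e : R, 0 < e -> exists2 d, 0 < d & forall h, 0 < h <= d ->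
    `|f (z + h%:C *: v + h%:C *: w) - f (z + h%:C *: v) - (f (z + h%:C *: w) - f z)
      - h ^+ 2 * rpartial w (rpartial v f) z| <= h ^+ 2 * e.
Proof.
move=> zB dv dw cvw e e0; set D := rpartial w _ z.
have FF := nbhs_filter (z : V).
have [d d0 H] := near_parallelogram v w (filterI (unit_ball_near zB) (cvgr_dist_lt _ _ cvw _ e0)).
 exists d => // h /andP[h0 hd].
have hh : 0 <= h <= d by rewrite ltW.
have z0 : 0 <= (0 : R) <= d by rewrite lexx ltW.
have sub (s : R) : 0 <= s <= h -> 0 <= s <= d.
  by case/andP => -> sh /=; exact: le_trans hd.
(* The second difference is the increment of [phi] from 0 to [h]. *)
pose phi (s : R) := f (z + h%:C *: w + s%:C *: v) - f (z + s%:C *: v).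
have [s|s hs phiE] := @MVT_closed phi
    (fun s => rpartial v f (z + h%:C *: w + s%:C *: v) - rpartial v f (z + s%:C *: v)) 0 h h0.
  move=> hs; apply: is_deriveB; apply: is_derive_along; apply: dv.
  - by rewrite addrAC; case: (H s h (sub _ hs) hh).
  - by have [+ _] := H s 0 (sub _ hs) z0; rewrite scale0r addr0.
have [t|t ht psiE] := @MVT_closed (fun t => rpartial v f (z + s%:C *: v + t%:C *: w))
    (fun t => rpartial w (rpartial v f) (z + s%:C *: v + t%:C *: w)) 0 h h0.
  by move=> ht; apply: is_derive_along; apply: dw; case: (H s t (sub _ hs) (sub _ ht)).
have -> : f (z + h%:C *: v + h%:C *: w) - f (z + h%:C *: v) - (f (z + h%:C *: w) - f z)
    = h ^+ 2 * rpartial w (rpartial v f) (z + s%:C *: v + t%:C *: w).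
  transitivity (phi h - phi 0).
    by rewrite /phi scale0r !addr0 [z + _ + h%:C *: v]addrAC.
  move: psiE; rewrite scale0r addr0 subr0 => psiE.
  by rewrite phiE subr0 [z + _ + _]addrAC psiE; ring.
rewrite -mulrBr normrM ger0_norm ?sqr_ge0 // ler_wpM2l ?sqr_ge0 //.
by rewrite distrC ltW //; case: (H s t (sub _ hs) (sub _ ht)).
Qed.

(** The second difference is symmetric in [v] and [w], so h^2 times either mixed derivative
    approximates it up to h^2 e / 2, with [e] arbitrary. *)
Lemma rpartialC f v w z :
  unit_ball z ->
  (forall x, unit_ball x -> derivable (along f x v) 0 1) ->
  (forall x, unit_ball x -> derivable (along f x w) 0 1) ->
  (forall x, unit_ball x -> derivable (along (rpartial v f) x w) 0 1) ->
  (forall x, unit_ball x -> derivable (along (rpartial w f) x v) 0 1) ->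
  {for z, continuous (rpartial w (rpartial v f) : V -> R)} ->
  {for z, continuous (rpartial v (rpartial w f) : V -> R)} ->
  rpartial w (rpartial v f) z = rpartial v (rpartial w f) z.
Proof.
move=> zB dv dw dvw dwv cvw cwv; apply/eqP; rewrite -subr_eq0 -normr_le0.
apply/ler_addgt0Pr => e e0; rewrite add0r.
have e20 : 0 < e / 2 by rewrite divr_gt0.
have [d1 d10 H1] := mixed_difference zB dv dvw cvw e20.
have [d2 d20 H2] := mixed_difference zB dw dwv cwv e20.
pose h := Num.min d1 d2.
have h0 : 0 < h by rewrite lt_min d10.
have := H1 h; rewrite h0 ge_min lexx => /(_ isT).
have := H2 h; rewrite h0 ge_min lexx orbT => /(_ isT).
rewrite [z + h%:C *: w + _]addrAC.
set A := f _; set B := f _; set B' := f _; set F := f _.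
move: (rpartial w _ z) (rpartial v _ z) => D1 D2 h2 h1.
have hh0 : 0 < h ^+ 2 by rewrite exprn_gt0.
rewrite -(ler_pM2l hh0) -{1}(gtr0_norm hh0) -normrM.
have -> : h ^+ 2 * (D1 - D2) = (A - B - (B' - F) - h ^+ 2 * D2) - (A - B' - (B - F) - h ^+ 2 * D1).
  by ring.
apply: le_trans (ler_normB _ _) _.
apply: le_trans (lerD h2 h1) _.
by rewrite -mulrDr -splitr.
Qed.

Lemma axis_segment_cst f z v (r : R) :
  (forall s : R, `|s| <= `|r| -> derivable (along f (z + s%:C *: v) v) 0 1) ->
  (forall s : R, `|s| <= `|r| -> rpartial v f (z + s%:C *: v) = 0) ->
  f (z + r%:C *: v) = f z.
Proof.
move=> dv v0; apply/eqP; rewrite -subr_eq0; apply/eqP.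
pose g (s : R) := f (z + s%:C *: v).
have -> : f (z + r%:C *: v) - f z = g r - g 0 by rewrite /g scale0r addr0.
have gd (s : R) : `|s| <= `|r| -> is_derive s 1 g 0.
  by move=> sr; have := is_derive_along (dv s sr); rewrite v0.
have [r0|r0|<-] := ltrgtP 0 r; last by rewrite subrr.
- have [s /andP[s0 sr]|c _ ->] := @MVT_closed g (fun=> 0) 0 r r0; last by rewrite mul0r.
  by apply: gd; rewrite (ger0_norm s0) (gtr0_norm r0).
- have [s /andP[s0 sr]|c _ h] := @MVT_closed g (fun=> 0) r 0 r0.
    by apply: gd; rewrite (ler0_norm sr) (ltr0_norm r0) lerN2.
  by apply: oppr_inj; rewrite opprB h mul0r oppr0.
Qed.

End MixedPartials.

(** * Functions with vanishing derivatives on the ball *)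

Section BallConstancy.
Context {R : realType} {n : nat}.
Local Notation C := R[i].
Implicit Types (z w : 'rV[C]_n).

Definition is_axis (v : 'rV[C]_n) := exists k, v = xdir k \/ v = ydir k.

Lemma normc_sqr (x : C) : ComplexField.Normc.normc x ^+ 2 = complex.Re x ^+ 2 + complex.Im x ^+ 2.
Proof. by case: x => a b /=; rewrite sqr_sqrtr // addr_ge0 // sqr_ge0. Qed.

(** Only axis derivatives are controlled, so [z] is joined to 0 along segments parallel to the axes,
    clearing one complex coordinate at a time. *)
Lemma ball_cst (f : 'rV[C]_n -> R) :
  (forall z v, unit_ball z -> is_axis v -> derivable (along f z v) 0 1) ->
  (forall z v, unit_ball z -> is_axis v -> rpartial v f z = 0) ->
  forall z, unit_ball z -> f z = f 0.
Proof.
move=> fd f0 z zB.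
pose trunc m : 'rV[C]_n := \row_j (if (j < m)%N then 0 else z 0 j).
suff H m : (m <= n)%N -> f z = f (trunc m).
  rewrite (H n (leqnn n)); congr f; apply/rowP => j.
  by rewrite !mxE ltn_ord.
elim: m => [_|m IH mn]; first by congr f; apply/rowP => j; rewrite !mxE ltn0.
rewrite (IH (ltnW mn)) {IH}.
pose k := Ordinal mn; set w := trunc m.+1.
have wE (s t : R) i : (w + s%:C *: xdir k + t%:C *: ydir k) 0 i =
    if i == k then s +i* t else w 0 i.
  rewrite !mxE eqxx /=; have [->|ik] := eqVneq i k.
    by rewrite ltnSn; apply: eqC => /=; ring.
  by rewrite !mulr0 !addr0.
(* Shrinking the real and imaginary parts of one coordinate does not increase [sqnorm], so both
   segments stay in the ball. *)
have wB (s t : R) : `|s| <= `|complex.Re (z 0 k)| -> `|t| <= `|complex.Im (z 0 k)| ->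
    unit_ball (w + s%:C *: xdir k + t%:C *: ydir k).
  move=> hs ht; apply: le_lt_trans zB; apply: ler_sum => i _; rewrite !normc_sqr wE.
  have [->|ik] := eqVneq i k; first by rewrite /= lerD // -real_normK ?num_real //
    -[leRHS]real_normK ?num_real // ler_pXn2r ?nnegrE.
  rewrite mxE; case: ifP => // _.
  by rewrite /= expr0n addr0 addr_ge0 ?sqr_ge0.
have -> : trunc m = w + (complex.Re (z 0 k))%:C *: xdir k + (complex.Im (z 0 k))%:C *: ydir k.
  apply/rowP => i; rewrite wE !mxE ltnS [(i <= m)%N]leq_eqVlt.
  have [->|ik] := eqVneq i k; first by rewrite /= ltnn; case: (z 0 k).
  by have /negPf -> : (i : nat) != m by apply: contra_neq ik => im; apply: val_inj.
have xk : is_axis (xdir k) by exists k; left.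
have yk : is_axis (ydir k) by exists k; right.
rewrite axis_segment_cst; first rewrite axis_segment_cst //.
- by move=> s hs; apply: fd => //; have := wB s 0 hs; rewrite scale0r addr0 normr0 => /(_ (normr_ge0 _)).
- by move=> s hs; apply: f0 => //; have := wB s 0 hs; rewrite scale0r addr0 normr0 => /(_ (normr_ge0 _)).
- by move=> s hs; apply: fd => //; exact: wB.
- by move=> s hs; apply: f0 => //; exact: wB.
Qed.

End BallConstancy.

(** * Second-order Wirtinger derivatives of real functions *)

Section SecondOrder.
Context {R : realType} {n : nat}.
Local Notation C := R[i].
Implicit Types (g : 'rV[C]_n -> R) (z : 'rV[C]_n) (i j k : 'I_n).

Lemma cpartial_cplx v g z : cpartial v (cplx g) z = (rpartial v g z)%:C.
Proof.
apply: eqC => //=; rewrite /rpartial derive1E.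
have -> : along (fun w => complex.Im (cplx g w)) z v = cst 0 by [].
exact: derive_cst.
Qed.

Lemma dz_cplxE k g z : dz k (cplx g) z =
  2^-1 * ((rpartial (xdir k) g z)%:C - 'i%C * (rpartial (ydir k) g z)%:C).
Proof. by rewrite /dz !cpartial_cplx. Qed.

Lemma dzbar_cplxE k g z : dzbar k (cplx g) z =
  2^-1 * ((rpartial (xdir k) g z)%:C + 'i%C * (rpartial (ydir k) g z)%:C).
Proof. by rewrite /dzbar !cpartial_cplx. Qed.

Lemma dz_cplx k g : dz k (cplx g) =
  fun z => 2^-1 * (cplx (rpartial (xdir k) g) z - 'i%C * cplx (rpartial (ydir k) g) z).
Proof. by apply/funext => z; rewrite /dz !cpartial_cplx. Qed.

Lemma dzbar_cplx k g : dzbar k (cplx g) =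
  fun z => 2^-1 * (cplx (rpartial (xdir k) g) z + 'i%C * cplx (rpartial (ydir k) g) z).
Proof. by apply/funext => z; rewrite /dzbar !cpartial_cplx. Qed.

Lemma cconj_half (q a b : R) :
  q%:C * (a%:C + 'i%C * b%:C) = (q%:C * (a%:C - 'i%C * b%:C))^*.
Proof. by apply: eqC => /=; ring. Qed.

Lemma dzbar_cplxJ k g z : dzbar k (cplx g) z = (dz k (cplx g) z)^*.
Proof.
rewrite dz_cplx dzbar_cplx /cplx.
have -> : 2^-1 = (2^-1 : R)%:C by rewrite fmorphV rmorph_nat.
exact: cconj_half.
Qed.

Lemma is_wirtinger_cplx k g z :
  (forall v, v = xdir k \/ v = ydir k -> derivable (along g z v) 0 1) ->
  is_wirtinger k (cplx g) z (dz k (cplx g) z) (dzbar k (cplx g) z).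
Proof.
move=> H; apply: derivable_is_wirtinger => v /H gd; split; first exact: gd.
exact: derivable_cst.
Qed.

(** [B] and [A'] are the derivatives in z_i and conj z_j taken in the two orders. Both expand into
    four real second derivatives, which [rpartialC] matches. *)
Lemma Cdiff2_wirtinger g i j z : Cdiff_on 2 unit_ball g -> unit_ball z ->
  exists A B A' B', [/\
    is_wirtinger j (dz i (cplx g)) z A B,
    is_wirtinger i (dzbar j (cplx g)) z A' B' & B = A'].
Proof.
move=> [_ g2] zB.
have W k v : v = xdir k \/ v = ydir k -> forall l,
    is_wirtinger l (cplx (rpartial v g)) z
      (dz l (cplx (rpartial v g)) z) (dzbar l (cplx (rpartial v g)) z).
  move=> /g2[_ [_ h]] l; apply: is_wirtinger_cplx => w wl.
  by have [+ _] := h l w wl; apply.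
have S k v l w : v = xdir k \/ v = ydir k -> w = xdir l \/ w = ydir l ->
    rpartial w (rpartial v g) z = rpartial v (rpartial w g) z.
  move=> hv hw; have [dv [_ hv']] := g2 _ _ hv; have [dw [_ hw']] := g2 _ _ hw.
  have [dvw [cvw _]] := hv' _ _ hw; have [dwv [cwv _]] := hw' _ _ hv.
  by apply: rpartialC => //; [exact: cvw|exact: cwv].
have xk k : xdir k = xdir k :> 'rV[C]_n \/ xdir k = ydir k :> 'rV[C]_n by left.
have yk k : ydir k = xdir k :> 'rV[C]_n \/ ydir k = ydir k :> 'rV[C]_n by right.
have H1 := is_wirtingerZ 2^-1 (is_wirtingerB (W _ _ (xk i) j) (is_wirtingerZ 'i%C (W _ _ (yk i) j))).
have H2 := is_wirtingerZ 2^-1 (is_wirtingerD (W _ _ (xk j) i) (is_wirtingerZ 'i%C (W _ _ (yk j) i))).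
rewrite -dz_cplx in H1; rewrite -dzbar_cplx in H2.
do 4 eexists; split; [exact: H1|exact: H2|].
(* Stated abstractly because rewriting in the goal would try to convert
   [xdir i] to [xdir j], which does not terminate in practice. *)
have E (q u a b c d a' b' c' d' A B A' B' : C) : a = a' -> b = b' -> c = c' -> d = d' ->
    A = q * (a + u * c) -> B = q * (b + u * d) ->
    A' = q * (a' - u * b') -> B' = q * (c' - u * d') ->
    q * (A - u * B) = q * (A' + u * B').
  by move=> <- <- <- <- -> -> -> ->; ring.
have S' k v l w (hv : v = xdir k \/ v = ydir k) (hw : w = xdir l \/ w = ydir l) :=
  congr1 (fun x : R => x%:C) (S _ _ _ _ hv hw).
exact: (E _ _ _ _ _ _ _ _ _ _ _ _ _ _
  (S' _ _ _ _ (xk i) (xk j)) (S' _ _ _ _ (yk i) (xk j))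
  (S' _ _ _ _ (xk i) (yk j)) (S' _ _ _ _ (yk i) (yk j))
  (dzbar_cplxE _ _ _) (dzbar_cplxE _ _ _) (dz_cplxE _ _ _) (dz_cplxE _ _ _)).
Qed.

End SecondOrder.

(** * Potentials of the Bergman metric *)

Section BallPotentials.
Context {R : realType} {n : nat}.
Local Notation C := R[i].
Local Notation N := (n.+1%:R : C).
Local Notation rho z := ((1 - sqnorm z)%:C).
Implicit Types (z w : 'rV[C]_n) (i j k : 'I_n).

Lemma dim_neq0 : N != 0.
Proof. by rewrite pnatr_eq0. Qed.

Lemma rho_neq0 z : unit_ball z -> rho z != 0.
Proof. by move=> zB; rewrite fmorph_eq0 subr_eq0 eq_sym lt_eqF. Qed.

Lemma rhoE z : rho z = 1 - \sum_i z 0 i * (z 0 i)^*.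
Proof. by rewrite rmorphB rmorph1 /= sqnormE. Qed.

Lemma is_wirtinger_uniq k (f : 'rV[C]_n -> C) z a b a' b' :
  is_wirtinger k f z a b -> is_wirtinger k f z a' b' -> a = a' /\ b = b'.
Proof.
move=> h h'; split.
- by rewrite -(is_wirtinger_dz h) (is_wirtinger_dz h').
- by rewrite -(is_wirtinger_dzbar h) (is_wirtinger_dzbar h').
Qed.

Lemma is_wirtinger_coordJ i k z : is_wirtinger k (fun w => (w 0 i)^*) z 0 (i == k)%:R.
Proof.
apply: is_wirtinger_eq (is_wirtingerJ (is_wirtinger_coord i k z)) _ _.
- by rewrite cconj0.
- by rewrite cconj_nat.
Qed.

Lemma is_wirtinger_rho k z :
  is_wirtinger k (fun w => rho w) z (- (z 0 k)^*) (- z 0 k).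
Proof.
have -> : (fun w : 'rV[C]_n => rho w) = (fun w => 1 - cplx (@sqnorm R n) w).
  by apply/funext => w; rewrite rmorphB rmorph1.
apply: is_wirtinger_eq
  (is_wirtingerB (is_wirtinger_cst k 1 z) (is_wirtinger_sqnorm k z)) _ _; by rewrite sub0r.
Qed.

Lemma is_wirtinger_rhoV k z : unit_ball z ->
  is_wirtinger k (fun w => (rho w)^-1) z
    ((z 0 k)^* * (rho z)^-1 ^+ 2) (z 0 k * (rho z)^-1 ^+ 2).
Proof.
move=> zB; have r0 := rho_neq0 zB.
apply: is_wirtinger_eq (is_wirtingerV r0 (is_wirtinger_rho k z)) _ _;
  by rewrite opprK exprVn.
Qed.

(** On the ball the derivative of ln rho in conj z_j is -z_j / rho; it remains to differentiate in
    z_i and multiply by -N. *)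
Lemma bergmanE z i j : unit_ball z -> bergman z i j =
  N * ((i == j)%:R * (rho z)^-1 + (z 0 i)^* * z 0 j * (rho z)^-1 ^+ 2).
Proof.
move=> zB.
have H1 w : unit_ball w -> -1 * (w 0 j * (rho w)^-1) =
    dzbar j (cplx (fun x : 'rV[C]_n => ln (1 - sqnorm x))) w.
  move=> wB; have rw0 : 0 < 1 - sqnorm w by rewrite subr_gt0.
  rewrite (is_wirtinger_dzbar (is_wirtinger_ln rw0 (is_wirtinger_rho j w))).
  by rewrite mulN1r mulNr.
have H2 := is_wirtingerZ (-1)
  (is_wirtingerM (is_wirtinger_coord j i z) (is_wirtinger_rhoV i zB)).
have H3 := is_wirtinger_near zB H1 H2.
rewrite /bergman mxE mxE (is_wirtinger_dz H3) eq_sym.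
by ring.
Qed.

(** The square of 1/rho is left as a product, to match the shape that [is_wirtingerM]
    differentiates. *)
Lemma bergmanJ z i j : unit_ball z -> (bergman z i j)^* =
  N * ((i == j)%:R * (rho z)^-1 + z 0 i * (z 0 j)^* * ((rho z)^-1 * (rho z)^-1)).
Proof.
have E (a b c d e : C) : a^* = a -> b^* = b -> c^* = c ->
    (a * (b * c + d^* * e * c ^+ 2))^* = a * (b * c + d * e^* * (c * c)).
  move=> aE bE cE; rewrite -{2}aE -{2}bE -{3 4 5}cE expr2.
  by case: a b c d e {aE bE cE} => [? ?] [? ?] [? ?] [? ?] [? ?]; apply: eqC => /=; ring.
move=> zB; rewrite bergmanE //; apply: E; [exact: cconj_nat|exact: cconj_nat|].
by rewrite cconjV cconj_real.
Qed.

(** The metric is a rank-one perturbation of a scalar matrix. Since P^2 = |z|^2 P = (1 - rho) P, the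
    inverse of I / rho + P / rho^2 is rho (I - P). *)
Lemma inv_metric_bergmanE z i j : unit_ball z -> inv_metric (bergman z) i j =
  N^-1 * rho z * ((i == j)%:R - z 0 i * (z 0 j)^*).
Proof.
move=> zB; have r0 := rho_neq0 zB; have N0 := dim_neq0.
pose P : 'M[C]_n := \matrix_(i, j) ((z 0 i)^* * z 0 j).
have PP : P *m P = (1 - rho z) *: P.
  apply/matrixP => a b; rewrite !mxE rhoE opprB addrC subrK mulr_suml.
  by apply: eq_bigr => c _; rewrite !mxE; ring.
have GE : bergman z = N *: ((rho z)^-1 *: (1%:M : 'M[C]_n) + (rho z)^-1 ^+ 2 *: P).
  by apply/matrixP => a b; rewrite bergmanE // !mxE; ring.
have GH : bergman z *m ((N^-1 * rho z) *: ((1%:M : 'M[C]_n) - P)) = 1%:M.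
  rewrite GE -scalemxAl -scalemxAr scalerA mulmxDl -!scalemxAl mul1mx mulmxBr mulmx1 PP.
  apply/matrixP => a b; rewrite !mxE; move: r0 N0; move: (rho z) N => r q r0 q0; field.
  by rewrite q0 r0.
have [GU _] := mulmx1_unit GH.
have -> : inv_metric (bergman z) = ((N^-1 * rho z) *: ((1%:M : 'M[C]_n) - P))^T.
  by rewrite /inv_metric -[X in _ = X^T](mulKmx GU) GH mulmx1.
by rewrite !mxE eq_sym [_^* * _]mulrC.
Qed.

Variable eta : 'rV[C]_n -> R.
Hypothesis eta_smooth : smooth_on unit_ball eta.
Hypothesis eta_potential : forall z, unit_ball z -> ddbar eta z = bergman z.

(** As [eta] is real, its derivative in conj z_k is the conjugate of the one in z_k. Conjugating the
    (i, k) entry of [ddbar eta] thus gives the derivative in conj z_i. *)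
Lemma dz_potential_wirtinger z : unit_ball z -> forall i k,
  is_wirtinger i (dz k (cplx eta)) z (dz i (dz k (cplx eta)) z) (bergman z i k)^*.
Proof.
move=> zB i k.
have [_ e3] := eta_smooth 3.
have W v l : v = xdir k \/ v = ydir k ->
    is_wirtinger l (cplx (rpartial v eta)) z
      (dz l (cplx (rpartial v eta)) z) (dzbar l (cplx (rpartial v eta)) z).
  move=> /e3[_ [_ h]]; apply: is_wirtinger_cplx => w wl.
  by have [+ _] := h l w wl; apply.
have [A [B H]] : exists A B, is_wirtinger i (dz k (cplx eta)) z A B.
  have H1 := is_wirtingerZ 2^-1 (is_wirtingerB (W _ i (or_introl erefl))
    (is_wirtingerZ 'i%C (W _ i (or_intror erefl)))).
  by rewrite -dz_cplx in H1; do 2 eexists; exact: H1.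
have -> : dz i (dz k (cplx eta)) z = A by exact: is_wirtinger_dz H.
suff <- : (B^*)^* = (bergman z i k)^* by rewrite cconjK.
congr (_ ^*); rewrite -eta_potential // mxE.
have EF : dzbar k (cplx eta) = (fun w => (dz k (cplx eta) w)^*).
  by apply/funext => w; exact: dzbar_cplxJ.
rewrite EF; exact/esym/(is_wirtinger_dz (is_wirtingerJ H)).
Qed.

(** [T] is the third derivative of [eta] in z_i, z_k and conj z_j. Symmetry is applied to the real
    partial derivatives of [eta] in x_k and y_k, which are C^2; [T] can then be computed from the
    explicit metric. *)
Lemma dz2_potential_wirtinger z : unit_ball z -> forall i j k,
  exists A T B, is_wirtinger j (dz i (dz k (cplx eta))) z A T /\
    is_wirtinger i (fun w => (bergman w j k)^*) z T B.
Proof.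
move=> zB i j k; have [_ e3] := eta_smooth 3.
have [_ gx] := e3 k _ (or_introl erefl); have [_ gy] := e3 k _ (or_intror erefl).
have [A1 [B1 [A1' [B1' [h1 h1' E1]]]]] := Cdiff2_wirtinger i j gx zB.
have [A2 [B2 [A2' [B2' [h2 h2' E2]]]]] := Cdiff2_wirtinger i j gy zB.
have W v l w : unit_ball w -> v = xdir k \/ v = ydir k ->
    is_wirtinger l (cplx (rpartial v eta)) w
      (dz l (cplx (rpartial v eta)) w) (dzbar l (cplx (rpartial v eta)) w).
  move=> wB /e3[_ [_ h]]; apply: is_wirtinger_cplx => x xl.
  by have [+ _] := h l x xl; apply.
have K l w (wB : unit_ball w) := is_wirtingerZ 2^-1 (is_wirtingerB (W _ l w wB (or_introl erefl))
   (is_wirtingerZ 'i%C (W _ l w wB (or_intror erefl)))).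
have H1 := is_wirtingerZ 2^-1 (is_wirtingerB h1 (is_wirtingerZ 'i%C h2)).
have H2 := is_wirtingerZ 2^-1 (is_wirtingerB h1' (is_wirtingerZ 'i%C h2')).
exists (2^-1 * (A1 - 'i%C * A2)), (2^-1 * (B1 - 'i%C * B2)), (2^-1 * (B1' - 'i%C * B2')); split.
- apply: is_wirtinger_near zB _ H1 => w wB.
  have := K i w wB; rewrite -dz_cplx => /is_wirtinger_dz; exact: esym.
- rewrite E1 E2; apply: is_wirtinger_near zB _ H2 => w wB.
  have := K j w wB; rewrite -dz_cplx => /is_wirtinger_dzbar <-.
  exact: is_wirtinger_dzbar (dz_potential_wirtinger wB j k).
Qed.

(* [f] is the (1,0)-part of the differential of the pluriharmonic function
   eta / N + ln (1 - |z|^2); it is holomorphic with derivatives [M]. *)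
Lemma potential_decomposition :
  exists (f : 'I_n -> 'rV[C]_n -> C) (M : 'I_n -> 'I_n -> 'rV[C]_n -> C),
  forall z, unit_ball z ->
  [/\ forall k, dz k (cplx eta) z = N * (f k z + (z 0 k)^* * (rho z)^-1),
      forall i k, is_wirtinger i (f k) z (M i k z) 0 &
      forall i j k, exists A, is_wirtinger j (M i k) z A 0].
Proof.
have N0 := dim_neq0.
(* The subtracted term comes from the derivative of ln rho in z_k, which is -conj z_k / rho. The
   second witness is the derivative of the first in z_i. *)
exists (fun k z => N^-1 * dz k (cplx eta) z - (z 0 k)^* * (rho z)^-1).
exists (fun i k z => N^-1 * dz i (dz k (cplx eta)) z
   - (z 0 k)^* * ((z 0 i)^* * ((rho z)^-1 * (rho z)^-1))).
move=> z zB; have r0 := rho_neq0 zB; split => [k|i k|i j k].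
- by move: N0; move: (rho z)^-1 N => r q q0; field.
- apply: is_wirtinger_eq (is_wirtingerB (is_wirtingerZ N^-1 (dz_potential_wirtinger zB i k))
    (is_wirtingerM (is_wirtinger_coordJ k i z) (is_wirtinger_rhoV i zB))) _ _.
    by ring.
  rewrite bergmanJ // mulKf // eq_sym; ring.
(* [T] is computed from the conjugated metric and cancels the derivative in conj z_j of the explicit
   term of [M i k]. *)
- have [A [T [B [hT hB]]]] := dz2_potential_wirtinger zB i j k.
  have q := is_wirtinger_rhoV i zB.
  have hB' := is_wirtingerZ N (is_wirtingerD
     (is_wirtingerZ (j == k)%:R q)
     (is_wirtingerM (is_wirtingerM (is_wirtinger_coord j i z) (is_wirtinger_coordJ k i z))
        (is_wirtingerM q q))).
  have := is_wirtinger_near zB _ hB'; move=> /(_ (fun w => (bergman w j k)^*)) [w wB|h1 h2].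
    by rewrite bergmanJ.
  have [TE _] := is_wirtinger_uniq hB (conj h1 h2).
  have q' := is_wirtinger_rhoV j zB.
  eexists; apply: is_wirtinger_eq (is_wirtingerB (is_wirtingerZ N^-1 hT)
    (is_wirtingerM (is_wirtinger_coordJ k j z) (is_wirtingerM (is_wirtinger_coordJ i j z)
      (is_wirtingerM q' q')))) _ _ => //.
  rewrite TE mulKf // [j == k]eq_sym [j == i]eq_sym; ring.
Qed.

End BallPotentials.

(** * Rigidity of the holomorphic differential *)

Section Rigidity.
Context {R : realType} {n : nat}.
Local Notation C := R[i].
Local Notation rho z := ((1 - sqnorm z)%:C).
Implicit Types (z w : 'rV[C]_n) (i j k : 'I_n).

Lemma cconj_invr_real (x : R) : ((x%:C)^-1)^* = (x%:C)^-1.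
Proof. by rewrite cconjV cconj_real. Qed.

Lemma sum_mulJ_eq0 (x : 'I_n -> C) :
  \sum_k x k * (x k)^* = 0 -> forall k, x k = 0.
Proof.
move=> x0 k; have /psumr_eq0P := x0; move=> /(_ (fun i _ => mul_cconj_ge0 (x i)) k isT)/eqP.
by rewrite mulf_eq0 cconj_eq0 orbb => /eqP.
Qed.

Lemma sqnorm0 : sqnorm (0 : 'rV[C]_n) = 0.
Proof. by apply: big1 => i _; rewrite mxE normc_sqr /= expr0n addr0. Qed.

Lemma unit_ball0 : unit_ball (0 : 'rV[C]_n).
Proof. by rewrite /unit_ball /= sqnorm0 ltr01. Qed.

(** With u_k = f_k + conj z_k / rho, the inverse metric turns the squared norm into N rho (|u|^2 -
    |z . u|^2), where z . u is bilinear. Expanding with |z|^2 = 1 - rho leaves N + N rho (|f|^2 - |1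
    - E|^2). *)
Lemma del_sqnorm_hermitian (eta : 'rV[C]_n -> R) (f : 'I_n -> C) z :
  unit_ball z ->
  (forall k, dz k (cplx eta) z = n.+1%:R * (f k + (z 0 k)^* * (rho z)^-1)) ->
  let E := \sum_k z 0 k * f k in
  (1 - E) * (1 - E)^* - \sum_k f k * (f k)^* =
    (1 - del_sqnorm bergman eta z / n.+1%:R) * (rho z)^-1.
Proof.
move=> zB Hf E; have r0 := rho_neq0 zB.
set S := \sum_k z 0 k * (z 0 k)^*; set F := \sum_k f k * (f k)^*.
have SE : S = 1 - rho z by rewrite rhoE opprB addrC subrK.
pose q := (rho z)^-1; have qJ : q^* = q by exact: cconj_invr_real.
have EJ : E^* = \sum_k (z 0 k)^* * (f k)^*.
  by rewrite cconj_sum; apply: eq_bigr => k _; rewrite cconjM.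
pose u k := f k + (z 0 k)^* * q.
have uJ k : (u k)^* = (f k)^* + z 0 k * q by rewrite /u cconjD cconjM cconjK qJ.
have U1 : \sum_k u k * (u k)^* = F + (E + E^*) * q + S * q ^+ 2.
  rewrite EJ /F /E /S mulrDl !mulr_suml -!big_split; apply: eq_bigr => k _ /=.
  by rewrite uJ /u; ring.
have U2 : \sum_k z 0 k * u k = E + S * q.
  by rewrite /E /S mulr_suml -big_split; apply: eq_bigr => k _ /=; rewrite /u; ring.
have U3 : \sum_k (z 0 k)^* * (u k)^* = E^* + S * q.
  by rewrite EJ /S mulr_suml -big_split; apply: eq_bigr => k _ /=; rewrite uJ; ring.
have -> : del_sqnorm bergman eta z = n.+1%:R * rho z *
    (\sum_k u k * (u k)^* - (\sum_k z 0 k * u k) * (\sum_k (z 0 k)^* * (u k)^*)).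
  have N0 := @dim_neq0 R n.
  rewrite mulr_suml -sumrB mulr_sumr /del_sqnorm; apply: eq_bigr => k _.
  have -> : u k * (u k)^* = \sum_j (k == j)%:R * (u k * (u j)^*).
    by rewrite (bigD1 k) //= eqxx mul1r big1 ?addr0 // => j /negPf jk; rewrite eq_sym jk mul0r.
  rewrite mulr_sumr -sumrB mulr_sumr; apply: eq_bigr => j _.
  rewrite inv_metric_bergmanE // dzbar_cplxJ !Hf.
  have -> : (n.+1%:R * (f j + (z 0 j)^* * (rho z)^-1))^* = n.+1%:R * (u j)^*.
    by rewrite cconjM; congr (_ * _); exact: cconj_nat.
  rewrite -/q -/(u k); move: N0; move: (n.+1%:R : C) (rho z) => m r m0.
  by field.
rewrite U1 U2 U3 SE cconjD cconjN; rewrite cconj1.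
rewrite /q; move: (@dim_neq0 R n) r0; move: (n.+1%:R : C) (rho z) => m r m0 r0.
by field; rewrite m0 r0.
Qed.

(* A matrix A with A J A^* = kappa I, for J = diag(1, -1, ..., -1) and kappa
   nonzero, would satisfy A^* A = kappa J, whose diagonal has entries of both
   signs; its rows are (1, a) and (-a_i, M_i). *)
Lemma gram_kappa_eq0 (a : 'rV[C]_n) (M : 'M[C]_n) (kappa : C) (k0 : 'I_n) :
  1 - \sum_k a 0 k * (a 0 k)^* = kappa ->
  (forall i, - a 0 i - \sum_k M i k * (a 0 k)^* = 0) ->
  (forall i j, a 0 i * (a 0 j)^* - \sum_k M i k * (M j k)^* = kappa * (i == j)%:R) ->
  kappa = 0.
Proof.
move=> h1 h2 h3; apply/eqP; apply/negP => /negP kap0.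
pose ac := map_mx (@cconj R) a; pose Mc := map_mx (@cconj R) M.
pose A : 'M[C]_(1 + n) := block_mx 1%:M a (- a^T) M.
(* [B] is J times the conjugate transpose of [A], so the hypotheses amount to A B = kappa I. *)
pose B : 'M[C]_(1 + n) := block_mx 1%:M (- ac) (- ac^T) (- Mc^T).
have AB : A *m B = kappa%:M.
  rewrite mulmx_block [kappa%:M]scalar_mx_block; congr block_mx.
  - apply/matrixP => i j; rewrite !ord1 mulmx1 !mxE -h1 mulr1n; congr (_ + _).
    by rewrite -sumrN; apply: eq_bigr => k _; rewrite !mxE mulrN.
  - apply/matrixP => i j; rewrite !ord1 mul1mx !mxE.
    transitivity ((0 : C)^*); last exact: cconj0.
    rewrite -[in RHS](h2 j) cconjD !cconjN cconj_sum -sumrN; congr (_ + _).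
    by apply: eq_bigr => k _; rewrite !mxE cconjM cconjK mulrN mulrC.
  - apply/matrixP => i j; rewrite !ord1 mulmx1 !mxE -[RHS](h2 i); congr (_ + _).
    by rewrite -sumrN; apply: eq_bigr => k _; rewrite !mxE mulrN.
  - apply/matrixP => i j; rewrite !mxE -mulr_natr -h3; congr (_ + _).
      by rewrite big_ord1 !mxE mulrNN.
    by rewrite -sumrN; apply: eq_bigr => k _; rewrite !mxE mulrN.
have BA : B *m A = kappa%:M.
  have : A *m (kappa^-1 *: B) = 1%:M.
    by rewrite -scalemxAr AB scale_scalar_mx mulVf.
  move=> /mulmx1C; rewrite -scalemxAl => h.
  by rewrite -scalemx1 -h scalerA mulfV // scale1r.
move: BA; rewrite mulmx_block [kappa%:M]scalar_mx_block => /eq_block_mx[b1 _ _ b4].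
(* The top left entry of B A is 1 plus a sum of squared moduli, while the diagonal entries of the
   lower right block are minus such sums. *)
have kp : 0 < kappa.
  have := congr1 (fun X : 'M[C]_1 => X 0 0) b1; rewrite mulmx1 !mxE eqxx !mulr1n => <-.
  rewrite ltr_pwDl ?ltr01 //; apply: sumr_ge0 => k _; rewrite !mxE mulrNN mulrC.
  exact: mul_cconj_ge0.
have kn : kappa <= 0.
  have := congr1 (fun X : 'M[C]_n => X k0 k0) b4; rewrite !mxE eqxx !mulr1n => <-.
  rewrite big_ord1 -oppr_ge0 opprD addr_ge0 //.
    by rewrite !mxE mulNr opprK mulrC; exact: mul_cconj_ge0.
  rewrite -sumrN; apply: sumr_ge0 => k _.
  by rewrite !mxE mulNr opprK mulrC; exact: mul_cconj_ge0.
by have := lt_le_trans kp kn; rewrite ltxx.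
Qed.

Lemma wirtinger_ball_cst (p : 'rV[C]_n -> C) :
  (forall z, unit_ball z -> forall i, is_wirtinger i p z 0 0) ->
  forall z, unit_ball z -> p z = p 0.
Proof.
move=> H z zB.
have D x v : unit_ball x -> is_axis v -> is_dirderive v p x 0.
  move=> xB [k [->|->]]; have [h1 h2] := H x xB k; first by move: h1; rewrite addr0.
  by move: h2; rewrite subr0 mulr0.
apply: eqC.
- apply: (@ball_cst R n (fun w => complex.Re (p w))) => // x v xB vA.
  + by have [[]] := D x v xB vA.
  + by have [[_ h] _] := D x v xB vA; rewrite /rpartial derive1E; exact: h.
- apply: (@ball_cst R n (fun w => complex.Im (p w))) => // x v xB vA.
  + by have [_ []] := D x v xB vA.
  + by have [_ [_ h]] := D x v xB vA; rewrite /rpartial derive1E; exact: h.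
Qed.

Variables (f : 'I_n -> 'rV[C]_n -> C) (M : 'I_n -> 'I_n -> 'rV[C]_n -> C) (kappa : C).
Hypothesis fW : forall z, unit_ball z -> forall i k, is_wirtinger i (f k) z (M i k z) 0.
Hypothesis MW : forall z, unit_ball z -> forall i j k, exists A, is_wirtinger j (M i k) z A 0.
Let E z := \sum_k z 0 k * f k z.
(** The derivative of [E] in z_i, by the product rule. *)
Let e i z := \sum_k ((k == i)%:R * f k z + z 0 k * M i k z).
Hypothesis hermitian : forall z, unit_ball z ->
  (1 - E z) * (1 - E z)^* - \sum_k f k z * (f k z)^* = kappa * (rho z)^-1.

Lemma E_wirtinger z : unit_ball z -> forall i,
  is_wirtinger i (fun w => 1 - E w) z (- e i z) 0.
Proof.
move=> zB i.
have h := is_wirtinger_sum (index_enum 'I_n)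
  (fun k => is_wirtingerM (is_wirtinger_coord k i z) (fW zB i k)).
apply: is_wirtinger_eq (is_wirtingerB (is_wirtinger_cst i 1 z) h) _ _.
- by rewrite sub0r.
- by rewrite big1 ?subrr // => k _; rewrite mul0r mulr0 addr0.
Qed.

Lemma e_wirtinger z : unit_ball z -> forall i j, exists A, is_wirtinger j (e i) z A 0.
Proof.
move=> zB i j.
have [A HA] := choice (MW zB i j).
have h := is_wirtinger_sum (index_enum 'I_n) (fun k =>
  is_wirtingerD (is_wirtingerZ (k == i)%:R (fW zB j k))
   (is_wirtingerM (is_wirtinger_coord k j z) (HA k))).
eexists; apply: is_wirtinger_eq h _ _; first by reflexivity.
by rewrite big1 // => k _; rewrite !mulr0 mul0r !addr0.
Qed.

(** The conjugated factors are antiholomorphic, so the derivative of [hermitian] in z_i falls on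
    [1 - E] and the [f k] alone. *)
Lemma hermitian_dz z : unit_ball z -> forall i,
  - e i z * (1 - E z)^* - \sum_k M i k z * (f k z)^* =
  kappa * ((z 0 i)^* * ((rho z)^-1 * (rho z)^-1)).
Proof.
move=> zB i.
have hE := E_wirtinger zB i.
have h := is_wirtingerB (is_wirtingerM hE (is_wirtingerJ hE))
  (is_wirtinger_sum (index_enum 'I_n)
    (fun k => is_wirtingerM (fW zB i k) (is_wirtingerJ (fW zB i k)))).
have h' := is_wirtinger_near zB hermitian h.
have [+ _] := is_wirtinger_uniq h' (is_wirtingerZ kappa (is_wirtinger_rhoV i zB)).
rewrite expr2 => <-; have J0 := @cconj0 R.
rewrite J0 mulr0 addr0; congr (_ - _).
by apply: eq_bigr => k _; rewrite mulr0 addr0.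
Qed.

(** In [hermitian_dz] the factors [e i] and [M i k] are holomorphic, so on the left a derivative in
    conj z_j acts on the conjugated factors only. *)
Lemma hermitian_dzbar z : unit_ball z -> forall i j,
  e i z * (e j z)^* - \sum_k M i k z * (M j k z)^* =
  kappa * ((i == j)%:R * ((rho z)^-1 * (rho z)^-1) +
    (z 0 i)^* * (z 0 j * (rho z)^-1 ^+ 2 * (rho z)^-1 + (rho z)^-1 * (z 0 j * (rho z)^-1 ^+ 2))).
Proof.
move=> zB i j.
have [A hA] := e_wirtinger zB i j; have [A' hA'] := choice (MW zB i j).
have h := is_wirtingerB
  (is_wirtingerM (is_wirtingerZ (-1) hA) (is_wirtingerJ (E_wirtinger zB j)))
  (is_wirtinger_sum (index_enum 'I_n)
    (fun k => is_wirtingerM (hA' k) (is_wirtingerJ (fW zB j k)))).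
have h' := is_wirtinger_near zB (_ : forall w, unit_ball w -> _ =
  kappa * ((w 0 i)^* * ((rho w)^-1 * (rho w)^-1))) h.
have q := is_wirtinger_rhoV j zB.
have [|_] := is_wirtinger_uniq (h' _) (is_wirtingerZ kappa
  (is_wirtingerM (is_wirtinger_coordJ i j z) (is_wirtingerM q q))).
  by move=> w wB; rewrite mulN1r hermitian_dz.
move=> <-; congr (_ - _); first by rewrite cconjN; ring.
by apply: eq_bigr => k _; rewrite mul0r add0r.
Qed.

(** At the origin rho = 1, E = 0 and [e i] equals [f i], so [hermitian] and its two derivatives
    become the hypotheses of [gram_kappa_eq0]. The argument in ['I_n] makes the dimension
    positive. *)
Lemma hermitian_kappa_eq0 : 'I_n -> kappa = 0.
Proof.
move=> k0; have B0 := unit_ball0.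
have r1 : (rho (0 : 'rV[C]_n))^-1 = 1 by rewrite sqnorm0 subr0 rmorph1 invr1.
have E0 : E 0 = 0 by apply: big1 => k _; rewrite mxE mul0r.
have J1 := @cconj1 R.
have J0 := @cconj0 R.
have z0 i : (0 : 'rV[C]_n) 0 i = 0 by rewrite mxE.
have e0 i : e i 0 = f i 0.
  rewrite /e (bigD1 i) //= eqxx mxE mul1r mul0r addr0 big1 ?addr0 // => k /negPf ->.
  by rewrite !mxE !mul0r addr0.
apply: (@gram_kappa_eq0 (\row_k f k 0) (\matrix_(i, k) M i k 0) kappa k0).
- have := hermitian B0; rewrite E0 r1 subr0 J1 !mulr1 => <-.
  by congr (_ - _); apply: eq_bigr => k _; rewrite !mxE.
- move=> i; have := hermitian_dz B0 i.
  rewrite E0 r1 subr0 J1 e0 z0 J0 mul0r !mulr1 mulr0 => h; rewrite -[RHS]h.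
  by rewrite mxE; congr (_ - _); apply: eq_bigr => k _; rewrite !mxE.
- move=> i j; have := hermitian_dzbar B0 i j; rewrite r1 !e0 !z0 J0 !mulr1 mul0r addr0 => <-.
  by rewrite !mxE; congr (_ - _); apply: eq_bigr => k _; rewrite !mxE.
Qed.

Lemma hermitian_rigidity : 'I_n -> exists a : 'I_n -> C,
  \sum_k a k * (a k)^* = 1 /\
  forall z, unit_ball z -> 1 + \sum_k z 0 k * a k != 0 /\
    forall k, f k z = a k / (1 + \sum_k z 0 k * a k).
Proof.
move=> k0; have kap0 := hermitian_kappa_eq0 k0.
have K0 z : unit_ball z -> \sum_k f k z * (f k z)^* = (1 - E z) * (1 - E z)^*.
  by move=> zB; apply/esym/eqP; rewrite -subr_eq0 hermitian // kap0 mul0r.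
(* If 1 - E vanished at [z], all [f k] would vanish there by [K0], hence E too, giving 1 = 0. *)
have E1 z : unit_ball z -> 1 - E z != 0.
  move=> zB; apply/eqP => h; have := K0 z zB; rewrite h mul0r => /sum_mulJ_eq0 f0.
  move: h; rewrite /E big1 => [/eqP|k _]; last by rewrite f0 mulr0.
  by rewrite subr0 oner_eq0.
(* By [K0] the map [p] takes values in the unit sphere. *)
pose p k z := f k z * (1 - E z)^-1.
have pW z : unit_ball z -> forall k i, is_wirtinger i (p k) z 0 0.
  move=> zB k i; have Ez := E1 z zB.
  have h := is_wirtingerM (fW zB i k) (is_wirtingerV Ez (E_wirtinger zB i)).
  apply: is_wirtinger_eq h _ _; last by rewrite oppr0 !mul0r mulr0 addr0.
  (* This is the numerator of the derivative of [p k]. The sum over [k] of its squared moduli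
     expands into four sums, given by [hermitian] and its derivatives with kappa = 0, and these
     cancel. *)
  suff /(_ k) X : forall k, M i k z * (1 - E z) + f k z * e i z = 0.
    have -> : M i k z / (1 - E z) + f k z * (- - e i z / (1 - E z) ^+ 2)
      = (M i k z * (1 - E z) + f k z * e i z) / (1 - E z) ^+ 2.
      by move: Ez; move: (1 - E z) => y y0; field.
    by rewrite X mul0r.
  apply: sum_mulJ_eq0.
  have D1 : \sum_k M i k z * (f k z)^* = - e i z * (1 - E z)^*.
    by apply/esym/eqP; rewrite -subr_eq0 hermitian_dz // kap0 mul0r.
  have D1' : \sum_k f k z * (M i k z)^* = - (e i z)^* * (1 - E z).
    have := congr1 (@cconj R) D1; rewrite cconj_sum cconjM cconjK cconjN => <-.
    by apply: eq_bigr => l _; rewrite cconjM cconjK mulrC.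
  have D2 : \sum_k M i k z * (M i k z)^* = e i z * (e i z)^*.
    by apply/esym/eqP; rewrite -subr_eq0 hermitian_dzbar // kap0 mul0r.
  transitivity ((1 - E z) * (1 - E z)^* * (\sum_k M i k z * (M i k z)^*)
    + (1 - E z) * (e i z)^* * (\sum_k M i k z * (f k z)^*)
    + e i z * (1 - E z)^* * (\sum_k f k z * (M i k z)^*)
    + e i z * (e i z)^* * (\sum_k f k z * (f k z)^*)).
    rewrite !mulr_sumr -!big_split; apply: eq_bigr => l _ /=.
    by rewrite cconjD !cconjM; ring.
  by rewrite D1 D1' D2 K0 //; ring.
have pC k z : unit_ball z -> p k z = p k 0.
  by apply: wirtinger_ball_cst => w wB i; exact: pW.
have fE k z : unit_ball z -> f k z = p k 0 * (1 - E z).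
  by move=> zB; rewrite -(pC k z zB) /p mulfVK // E1.
(* The constant value of [p] is read off at 0, where E = 0; it is a unit vector by [K0]. *)
exists (fun k => p k 0); split.
  have := K0 0 unit_ball0; rewrite (_ : 1 - E 0 = 1); last first.
    by rewrite /E big1 ?subr0 // => k _; rewrite mxE mul0r.
  rewrite cconj1.
  rewrite mulr1 => <-; apply: eq_bigr => k _.
  suff -> : p k 0 = f k 0 by [].
  by rewrite /p /E big1 ?subr0 ?invr1 ?mulr1 // => l _; rewrite mxE mul0r.
move=> z zB; set T := \sum_k _.
(* Inserting f_k = a_k (1 - E) into the definition of E gives E = T (1 - E), which is solved for 1 -
   E. *)
have ET : (1 - E z) * (1 + T) = 1.
  have EE : E z = T * (1 - E z).
    by rewrite {1}/E /T mulr_suml; apply: eq_bigr => k _; rewrite (fE k z zB) mulrA.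
  by rewrite mulrDr mulr1 mulrC -EE subrK.
have T0 : 1 + T != 0.
  by apply/eqP => h; move: ET; rewrite h mulr0 => /eqP; rewrite eq_sym oner_eq0.
split=> // k; rewrite (fE k z zB); congr (_ * _).
by apply: (mulIf T0); rewrite ET mulVf.
Qed.

End Rigidity.

(** * Unitary automorphisms *)

Section Unitary.
Context {R : realType} {n : nat}.
Local Notation C := R[i].
Local Notation V := ('rV[C]_n : normedModType C).
Implicit Types (A : 'M[C]_n) (z : 'rV[C]_n).

Lemma sqnorm_mulmx A z : A *m (map_mx cconj A)^T = 1%:M -> sqnorm (z *m A) = sqnorm z.
Proof.
move=> AA; apply: complexI; rewrite !sqnormE.
have E (u : 'rV[C]_n) : \sum_j u 0 j * (u 0 j)^* = (u *m (map_mx cconj u)^T) 0 0.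
  by rewrite mxE; apply: eq_bigr => j _; rewrite !mxE.
have -> : \sum_j (z *m A) 0 j * ((z *m A) 0 j)^*
    = (z *m A *m ((map_mx cconj A)^T *m (map_mx cconj z)^T)) 0 0.
  rewrite [RHS]mxE; apply: eq_bigr => j _; congr (_ * _).
  rewrite !mxE cconj_sum; apply: eq_bigr => k _.
  by rewrite !mxE cconjM mulrC.
by rewrite E -mulmxA (mulmxA A) AA mul1mx.
Qed.

Lemma mulmx_holomorphic A : holomorphic_on unit_ball (fun z => z *m A).
Proof.
move=> z _.
have -> : (fun w => w *m A) = \sum_(i < n) (fun w : V => (w 0 i) *: row i A : V).
  by apply/funext => w; rewrite mulmx_sum_row fct_sumE.
apply: differentiable_sum => i; apply: differentiableZl.
exact: differentiable_coord.
Qed.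

Lemma unitary_automorphism A : A *m (map_mx cconj A)^T = 1%:M ->
  automorphism_on unit_ball (fun z : 'rV[C]_n => z *m A).
Proof.
move=> AA; have BB := mulmx1C AA.
have CC : (map_mx cconj A)^T *m (map_mx cconj (map_mx cconj A)^T)^T = 1%:M.
  have -> : map_mx cconj (map_mx cconj A)^T = A^T.
    by apply/matrixP => i j; rewrite !mxE cconjK.
  by rewrite trmxK.
exists (fun z => z *m (map_mx cconj A)^T); split.
- by move=> z; rewrite /unit_ball /= sqnorm_mulmx.
- by move=> z; rewrite /unit_ball /= sqnorm_mulmx.
- exact: mulmx_holomorphic.
- exact: mulmx_holomorphic.
- by move=> z _; rewrite -!mulmxA AA BB !mulmx1.
Qed.

End Unitary.

(** * Unitary matrices with a prescribed last column *)

Section UnitaryCompletion.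
Context {R : realType} {n : nat}.
Local Notation C := R[i].

Lemma unitary_completion (b : 'I_n.+1 -> C) : \sum_k b k * (b k)^* = 1 ->
  exists A : 'M[C]_n.+1, A *m (map_mx cconj A)^T = 1%:M /\
    forall k, A k ord_max = b k.
Proof.
(* Every row of [B] is [b], but only the first matters: [schmidt] returns a unitary matrix even at
   rank one, and [b] is a multiple of its first row. *)
move=> b1; pose B : 'M[C]_n.+1 := \matrix_(i, j) b j.
have UU : schmidt B *m (map_mx cconj (schmidt B))^T = 1%:M.
  have /unitarymxP := schmidt_unitarymx B (leqnn _).
  by rewrite map_trmx.
move: (row_schmidt_sub B ord0); move: (schmidt B) UU => U UU.
rewrite (big_pred1 ord0) => [|i]; last by rewrite leqn0.
rewrite genmxE => /sub_rVP[c bE].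
have {}bE k : b k = c * U ord0 k.
  by have := congr1 (fun v : 'rV[C]_n.+1 => v 0 k) bE; rewrite !mxE.
have UE i j : \sum_k U i k * (U j k)^* = (i == j)%:R.
  have := congr1 (fun X : 'M[C]_n.+1 => X i j) UU; rewrite !mxE => <-.
  by apply: eq_bigr => k _; rewrite !mxE.
(* Both [b] and the first row of [U] are unit vectors, so scaling all of [U] by [c] keeps it
   unitary. *)
have cc : c * c^* = 1.
  rewrite -b1 -[LHS]mulr1 -[1](UE ord0 ord0) mulr_sumr.
  by apply: eq_bigr => k _; rewrite bE cconjM; ring.
(* The transposition moves the row [b] to the last index, and the final transpose makes it the last
   column. *)
pose s := tperm (ord0 : 'I_n.+1) ord_max.
pose W : 'M[C]_n.+1 := \matrix_(i, j) (c * U (s i) j).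
have WW : W *m (map_mx cconj W)^T = 1%:M.
  apply/matrixP => i j; rewrite !mxE -(inj_eq (@perm_inj _ s)) -UE -[RHS]mul1r -cc mulr_sumr.
  by apply: eq_bigr => k _; rewrite !mxE cconjM; ring.
exists W^T; split.
  rewrite -[RHS]trmx1 -(mulmx1C WW) trmx_mul trmxK; congr (_ *m _).
  by apply/matrixP => i j; rewrite !mxE.
by move=> k; rewrite !mxE tpermR bE.
Qed.

End UnitaryCompletion.

(** * Identification of the potential with the logarithm of [phi0] *)

Lemma ln_phi0_mulmx (R : realType) (n : nat) (A : 'M[R[i]]_n.+1) (a : 'I_n.+1 -> R[i])
    (z : 'rV[R[i]]_n.+1) :
  A *m (map_mx cconj A)^T = 1%:M -> (forall k, A k ord_max = - a k) ->
  unit_ball z -> 1 + \sum_k z 0 k * a k != 0 ->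
  ln (phi0 (z *m A)) = n.+2%:R *
    (ln (complex.Re (1 + \sum_k z 0 k * a k) ^+ 2 + complex.Im (1 + \sum_k z 0 k * a k) ^+ 2)
     - ln (1 - sqnorm z)).
Proof.
move=> AA Aa zB; set L := 1 + _ => L0; rewrite /phi0 sqnorm_mulmx //.
have -> : 1 - (z *m A) 0 ord_max = L.
  rewrite mxE /L -sumrN; congr (_ + _); apply: eq_bigr => k _.
  by rewrite Aa mulrN opprK.
have r0 : 0 < 1 - sqnorm z by rewrite subr_gt0.
have L2 : 0 < complex.Re L ^+ 2 + complex.Im L ^+ 2.
  rewrite lt_def addr_ge0 ?sqr_ge0 // andbT; apply/eqP => h.
  move: (mulCJ L); rewrite h => /eqP; rewrite mulf_eq0 cconj_eq0 orbb.
  by rewrite (negPf L0).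
(* The even exponent makes [phi0] the power [n.+2] of |L|^2 / rho, so its logarithm splits. *)
rewrite exprM normc_sqr ln_div ?posrE ?exprn_gt0 // !lnXn //.
by rewrite -mulrnBl mulr_natl.
Qed.

Theorem corollary1p2 (R : realType) (n : nat) (eta : 'rV[R[i]]_n.+1 -> R)
  (eta_smooth : smooth_on unit_ball eta)
  (eta_potential : forall z : 'rV[R[i]]_n.+1,
     unit_ball z -> ddbar eta z = bergman z)
  (eta_const_norm : forall z w : 'rV[R[i]]_n.+1,
     unit_ball z -> unit_ball w ->
     del_norm bergman eta z = del_norm bergman eta w) :
  exists (tau : 'rV[R[i]]_n.+1 -> 'rV[R[i]]_n.+1) (b : R),
    [/\ automorphism_on unit_ball tau, tau 0 = 0 &
        forall z : 'rV[R[i]]_n.+1,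
          unit_ball z -> eta z = ln (phi0 (tau z)) + b].
Proof.
have [f [M fM]] := potential_decomposition eta_smooth eta_potential.
(* The constant kappa is evaluated at the origin. Squaring the constant norm, by [sqrtCK], shows
   that the squared norm is constant. *)
have [a [a1 fa]] := @hermitian_rigidity R n.+1 f M
    (1 - del_sqnorm bergman eta 0 / n.+2%:R)
    (fun z zB => let: And3 _ h _ := fM z zB in h)
    (fun z zB => let: And3 _ _ h := fM z zB in h)
    (fun z zB => let: And3 h _ _ := fM z zB in
       etrans (del_sqnorm_hermitian zB h)
         (congr1 (fun x => (1 - x / n.+2%:R) * ((1 - sqnorm z)%:C)^-1)
           (etrans (esym (sqrtCK _)) (etrans (congr1 (fun x => x ^+ 2)
             (eta_const_norm z 0 zB unit_ball0)) (sqrtCK _)))))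
    ord0.
(* The sign makes 1 minus the last coordinate of [z *m A] equal to 1 + \sum_k z_k a_k. *)
have [|A [AA Aa]] := @unitary_completion R n (fun k => - a k).
  by rewrite -a1; apply: eq_bigr => k _; rewrite cconjN mulrNN.
pose L (z : 'rV[R[i]]_n.+1) := 1 + \sum_k z 0 k * a k.
pose r z := complex.Re (L z) ^+ 2 + complex.Im (L z) ^+ 2.
have LW i z : is_wirtinger i L z (a i) 0.
  have h := is_wirtingerD (is_wirtinger_cst i 1 z) (is_wirtinger_sum (index_enum _)
    (fun k => is_wirtingerM (is_wirtinger_coord k i z) (is_wirtinger_cst i (a k) z))).
  apply: is_wirtinger_eq h _ _; rewrite add0r.
    rewrite (bigD1 i) //= eqxx mul1r mulr0 addr0 big1 ?addr0 // => k /negPf ->.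
    by rewrite mul0r mulr0 addr0.
  by rewrite big1 // => k _; rewrite mul0r mulr0 addr0.
(* The subtracted term is the logarithm of [phi0] at [z *m A]; it remains to show that [h] is
   constant. *)
pose h z := eta z - n.+2%:R * (ln (r z) - ln (1 - sqnorm z)).
have hW z : unit_ball z -> forall i, is_wirtinger i (cplx h) z 0 0.
  move=> zB i; have [L0 fE] := fa z zB.
  have r0 : 0 < r z.
    rewrite lt_def addr_ge0 ?sqr_ge0 // andbT; apply/eqP => rz0.
    move: (mulCJ (L z)); rewrite -/(r z) rz0 => /eqP; rewrite mulf_eq0 cconj_eq0 orbb.
    by rewrite (negPf L0).
  have rho0 : 0 < 1 - sqnorm z by rewrite subr_gt0.
  have rW : is_wirtinger i (cplx r) z (a i * (L z)^*) (L z * (a i)^*).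
    have -> : cplx r = (fun w => L w * (L w)^*).
      by apply/funext => w; rewrite mulCJ.
    apply: is_wirtinger_eq (is_wirtingerM (LW i z) (is_wirtingerJ (LW i z))) _ _.
      by rewrite cconj0 mulr0 addr0.
    by rewrite mul0r add0r.
  have [_ e1] := eta_smooth 1%N.
  have eW : is_wirtinger i (cplx eta) z (dz i (cplx eta) z) (dzbar i (cplx eta) z).
    by apply: is_wirtinger_cplx => v /e1[+ _]; apply.
  have cW := is_wirtingerB eW (is_wirtingerZ n.+2%:R
    (is_wirtingerB (is_wirtinger_ln r0 rW) (is_wirtinger_ln rho0 (is_wirtinger_rho i z)))).
  have hE : cplx h = (fun w => cplx eta w - n.+2%:R *
      (cplx (fun w => ln (r w)) w - cplx (fun w => ln (1 - sqnorm w)) w)).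
    by apply/funext => w; rewrite /cplx /h rmorphB rmorphM rmorphB rmorph_nat.
  rewrite -hE in cW.
  (* The derivatives in z_i of [eta] and of the subtracted term both equal N (a_i / L + conj z_i /
     rho). *)
  have d0 : dz i (cplx h) z = 0.
    rewrite (is_wirtinger_dz cW); have [-> _ _] := fM z zB.
    rewrite fE -/(L z) -mulCJ; have LJ0 : (L z)^* != 0 by rewrite cconj_eq0.
    move: (rho_neq0 zB) (L0) LJ0; rewrite -/(L z).
    move: ((1 - sqnorm z)%:C) (L z) ((L z)^*) => x y y' x0 y0 y'0.
    by field; rewrite x0 y0 y'0.
  have db0 : dzbar i (cplx h) z = 0 by rewrite dzbar_cplxJ d0 cconj0.
  by rewrite -{1}d0 -{1}db0 (is_wirtinger_dz cW) (is_wirtinger_dzbar cW).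
(* The additive constant is the value of [h] at the origin. *)
exists (fun z => z *m A), (h 0); split.
- exact: unitary_automorphism.
- exact: mul0mx.
- move=> z zB; have [L0 _] := fa z zB.
  have /complexI <- := wirtinger_ball_cst hW zB.
  by rewrite (ln_phi0_mulmx AA Aa zB L0) /h addrC subrK.
Qed.
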